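(* Let $M\in\mathbb{C}^{p\times p}$ be invertible, $\mathcal{A}\in\mathbb{C}^{m\times k\times p}$, $\mathcal{B}\in\mathbb{C}^{s\times n\times p}$ and $\mathcal{C}\in\mathbb{C}^{m\times n\times p}$, and let $\mathcal{A}^{(1)}$ and $\mathcal{B}^{(1)}$ be inner inverses of $\mathcal{A}$ and $\mathcal{B}$. Then the tensor equation $\mathcal{A}*_M\mathcal{X}*_M\mathcal{B}=\mathcal{C}$ in the unknown $\mathcal{X}\in\mathbb{C}^{k\times s\times p}$ is consistent (has a solution) if and only if $\mathcal{A}*_M\mathcal{A}^{(1)}*_M\mathcal{C}*_M\mathcal{B}^{(1)}*_M\mathcal{B}=\mathcal{C}$. In this case, the general solution is $$\mathcal{X}=\mathcal{A}^{(1)}*_M\mathcal{C}*_M\mathcal{B}^{(1)}+\mathcal{Z}-\mathcal{A}^{(1)}*_M\mathcal{A}*_M\mathcal{Z}*_M\mathcal{B}*_M\mathcal{B}^{(1)},\qquad \mathcal{Z}\in\mathbb{C}^{k\times s\times p},$$ that is, every tensor of this form is a solution, and every solution is of this form for some $\mathcal{Z}\in\mathbb{C}^{k\times s\times p}$.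
   Context: For $\mathcal{A}\in\mathbb{C}^{m\times n\times p}$, $\mathcal{A}(:,:,i)\in\mathbb{C}^{m\times n}$ ($1\le i\le p$) denotes the $i$-th frontal slice. For the fixed invertible matrix $M\in\mathbb{C}^{p\times p}$, $\tilde{\mathcal{A}}:=\mathcal{A}\times_3 M$ is defined by $\tilde{\mathcal{A}}(i_1,i_2,k)=\sum_{i_3=1}^p \mathcal{A}(i_1,i_2,i_3)M(k,i_3)$. The $M$-product of $\mathcal{A}\in\mathbb{C}^{m\times n\times p}$ and $\mathcal{B}\in\mathbb{C}^{n\times k\times p}$ is the tensor $\mathcal{A}*_M\mathcal{B}\in\mathbb{C}^{m\times k\times p}$ given by $\mathcal{A}*_M\mathcal{B}=\mathcal{W}\times_3 M^{-1}$, where $\mathcal{W}(:,:,i)=\tilde{\mathcal{A}}(:,:,i)\,\tilde{\mathcal{B}}(:,:,i)$ for $i=1,\dots,p$. An inner inverse of $\mathcal{A}\in\mathbb{C}^{m\times n\times p}$ is a tensor $\mathcal{A}^{(1)}\in\mathbb{C}^{n\times m\times p}$ with $\mathcal{A}*_M\mathcal{A}^{(1)}*_M\mathcal{A}=\mathcal{A}$. *)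

(* Defs.v *)
From HB Require Import structures.
From mathcomp Require Import all_boot all_order all_algebra.
From mathcomp Require Import reals.
From mathcomp Require Export complex.

Set Implicit Arguments.
Unset Strict Implicit.
Unset Printing Implicit Defensive.

Import GRing.Theory.
Local Open Scope ring_scope.

(* An m x n x p tensor is the finite family of its frontal slices: [A l i j] is
   the entry A(i, j, l) and [A l] is the slice A(:, :, l).  The entrywise sum
   and difference of tensors are those of the zmodType {ffun _ -> _}. *)
Notation "''T[' F ]_ ( m , n , p )" := {ffun 'I_p -> 'M[F]_(m, n)}
  (at level 0, F, m, n, p at level 99,
   format "''T[' F ]_ ( m ,  n ,  p )") : type_scope.

Definition mode3_prod (F : fieldType) (m n p : nat)
    (A : 'T[F]_(m, n, p)) (M : 'M[F]_p) : 'T[F]_(m, n, p) :=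
  [ffun k => \matrix_(i, j) \sum_(l < p) A l i j * M k l].

Notation "A *3 M" := (mode3_prod A M)
  (at level 40, left associativity) : ring_scope.

Definition tensor_prod (F : fieldType) (p : nat) (M : 'M[F]_p) (m n k : nat)
    (A : 'T[F]_(m, n, p)) (B : 'T[F]_(n, k, p)) : 'T[F]_(m, k, p) :=
  [ffun i => (A *3 M) i *m (B *3 M) i] *3 invmx M.

Notation "A *_[ M ] B" := (tensor_prod M A B)
  (at level 40, left associativity, format "A  *_[ M ]  B") : ring_scope.

Definition inner_inverse (F : fieldType) (p : nat) (M : 'M[F]_p) (m n : nat)
    (A : 'T[F]_(m, n, p)) (A1 : 'T[F]_(n, m, p)) : Prop :=
  A *_[M] A1 *_[M] A = A.

(* Main.v *)
(* Under the invertible change of basis _ *3 M the M-product becomes the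
   slicewise matrix product, so it inherits associativity and bilinearity;
   the theorem is then the classical argument for the matrix equation AXB = C,
   where a given solution X is recovered by the parameter Z = X. *)
Require Import Defs.
From mathcomp Require Import all_boot all_order all_algebra.
From mathcomp Require Import reals.

Import GRing.Theory.
Local Open Scope ring_scope.

Section TensorProduct.
Context {F : fieldType} {p : nat}.
Implicit Types (m n k l : nat) (M N : 'M[F]_p).

(** Seeing each slice as a linear combination of slices lets the laws of [*3] follow from module
    laws, without matrix entries. *)
Lemma mode3_prodE m n (A : 'T[F]_(m, n, p)) M q :
  (A *3 M) q = \sum_(r < p) M q r *: A r.
Proof.
apply/matrixP => i j; rewrite ffunE mxE summxE.
by apply: eq_bigr => r _; rewrite mxE mulrC.
Qed.

Lemma mode3_prodD m n (A B : 'T[F]_(m, n, p)) M :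
  (A + B) *3 M = A *3 M + B *3 M.
Proof.
apply/ffunP => q; rewrite [RHS]ffunE !mode3_prodE -big_split /=.
by apply: eq_bigr => r _; rewrite ffunE scalerDr.
Qed.

Lemma mode3_prodN m n (A : 'T[F]_(m, n, p)) M : (- A) *3 M = - (A *3 M).
Proof.
apply/ffunP => q; rewrite [RHS]ffunE !mode3_prodE -sumrN.
by apply: eq_bigr => r _; rewrite ffunE scalerN.
Qed.

Lemma mode3_prodM m n (A : 'T[F]_(m, n, p)) M N :
  A *3 M *3 N = A *3 (N *m M).
Proof.
apply/ffunP => q; rewrite !mode3_prodE.
under eq_bigr => r _ do rewrite mode3_prodE scaler_sumr.
rewrite exchange_big; apply: eq_bigr => t _ /=.
by rewrite mxE scaler_suml; apply: eq_bigr => r _; rewrite scalerA.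
Qed.

Lemma mode3_prod1 m n (A : 'T[F]_(m, n, p)) : A *3 1%:M = A.
Proof.
apply/ffunP => q; rewrite mode3_prodE (bigD1 q) //= mxE eqxx scale1r.
rewrite big1 ?addr0 // => r; rewrite eq_sym => /negPf neq_rq.
by rewrite mxE neq_rq scale0r.
Qed.

Lemma mode3_prodVK m n (A : 'T[F]_(m, n, p)) M :
  M \in unitmx -> A *3 invmx M *3 M = A.
Proof. by move=> M_inv; rewrite mode3_prodM mulmxV // mode3_prod1. Qed.

(** The outer [invmx M] of the nested product cancels against the [M] applied next, leaving triple
    matrix products slice by slice. *)
Lemma tensor_prodA M (M_inv : M \in unitmx) m n k l
    (A : 'T[F]_(m, n, p)) (B : 'T[F]_(n, k, p)) (C : 'T[F]_(k, l, p)) :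
  A *_[M] (B *_[M] C) = A *_[M] B *_[M] C.
Proof.
rewrite /tensor_prod !mode3_prodVK //; congr (_ *3 _).
by apply/ffunP => q; rewrite !ffunE mulmxA.
Qed.

Lemma tensor_prodDl M m n k (A B : 'T[F]_(m, n, p)) (C : 'T[F]_(n, k, p)) :
  (A + B) *_[M] C = A *_[M] C + B *_[M] C.
Proof.
(* The first rewrite merges the outer transforms on the right, the second splits the inner transform
   on the left. *)
rewrite /tensor_prod -mode3_prodD mode3_prodD; congr (_ *3 _).
by apply/ffunP => q; rewrite !ffunE mulmxDl.
Qed.

Lemma tensor_prodDr M m n k (A : 'T[F]_(m, n, p)) (B C : 'T[F]_(n, k, p)) :
  A *_[M] (B + C) = A *_[M] B + A *_[M] C.
Proof.
rewrite /tensor_prod -mode3_prodD mode3_prodD; congr (_ *3 _).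
by apply/ffunP => q; rewrite !ffunE mulmxDr.
Qed.

Lemma tensor_prodNl M m n k (A : 'T[F]_(m, n, p)) (B : 'T[F]_(n, k, p)) :
  (- A) *_[M] B = - (A *_[M] B).
Proof.
rewrite /tensor_prod -mode3_prodN mode3_prodN; congr (_ *3 _).
by apply/ffunP => q; rewrite !ffunE mulNmx.
Qed.

Lemma tensor_prodNr M m n k (A : 'T[F]_(m, n, p)) (B : 'T[F]_(n, k, p)) :
  A *_[M] (- B) = - (A *_[M] B).
Proof.
rewrite /tensor_prod -mode3_prodN mode3_prodN; congr (_ *3 _).
by apply/ffunP => q; rewrite !ffunE mulmxN.
Qed.

End TensorProduct.

Theorem theorem4p1 (R : realType) (m n k s p : nat) (M : 'M[R[i]]_p)
    (A : 'T[R[i]]_(m, k, p)) (B : 'T[R[i]]_(s, n, p)) (C : 'T[R[i]]_(m, n, p))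
    (A1 : 'T[R[i]]_(k, m, p)) (B1 : 'T[R[i]]_(n, s, p))
    (M_inv : M \in unitmx)
    (A1_inner : inner_inverse M A A1) (B1_inner : inner_inverse M B B1) :
  ((exists X : 'T[R[i]]_(k, s, p), A *_[M] X *_[M] B = C) <->
   A *_[M] A1 *_[M] C *_[M] B1 *_[M] B = C) /\
  ((exists X : 'T[R[i]]_(k, s, p), A *_[M] X *_[M] B = C) ->
   forall X : 'T[R[i]]_(k, s, p),
     A *_[M] X *_[M] B = C <->
     exists Z : 'T[R[i]]_(k, s, p),
       X = A1 *_[M] C *_[M] B1 + Z - A1 *_[M] A *_[M] Z *_[M] B *_[M] B1).
Proof.
rewrite /inner_inverse in A1_inner B1_inner.
(* M_inv is discharged once here: using // on an equation between M-products
   would unfold them and not terminate in practice. *)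
have mulA := tensor_prodA _ M_inv.
(* Multiplying by [A] and [B] does not see the map [X] to [A1 A X B B1]. This gives both the
   necessity of the criterion and the cancellation of [Z]. *)
have sandwich (X : 'T[R[i]]_(k, s, p)) :
    A *_[M] (A1 *_[M] A *_[M] X *_[M] B *_[M] B1) *_[M] B = A *_[M] X *_[M] B.
  rewrite !mulA A1_inner.
  (* Fixing the left factor [A X] regroups the rest as [B B1 B]. *)
  by rewrite -2!(mulA _ _ _ _ (A *_[M] X)) B1_inner.
have consistent (X : 'T[R[i]]_(k, s, p)) : A *_[M] X *_[M] B = C ->
    A *_[M] A1 *_[M] C *_[M] B1 *_[M] B = C.
  by move=> XC; rewrite -[RHS]XC -sandwich -XC !mulA.
split.
  split=> [[X] | AC]; first exact: consistent.
  (* This particular solution is the case [Z = 0] of the general formula. *)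
  by exists (A1 *_[M] C *_[M] B1); rewrite !mulA.
move=> [X0 /consistent AC] X; split=> [XC | [Z ->]].
  by exists X; rewrite -XC !mulA addrAC subrr add0r.
rewrite tensor_prodDr tensor_prodNr tensor_prodDr.
rewrite tensor_prodDl tensor_prodNl tensor_prodDl.
(* The two terms in [Z] cancel; what remains is the criterion [AC] up to association. *)
by rewrite [X in _ - X]sandwich addrK !mulA.
Qed.
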